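(* Let $1<\alpha\le2$, $|\theta|\le\min\{\alpha,2-\alpha\}$, let $f\in C^\infty(\mathbb{R})$ satisfy $f(0)=0=f(1)$, $f'(0)<0$, $f'(1)<0$, and suppose there are constants $0<a^-\le a^+<1$ such that $f>0$ in $(-1,0)\cup(a^+,1)$ and $f<0$ in $(0,a^-)\cup(1,2)$. Put $\mathcal A[u]=D^\alpha_\theta u+f(u)$ and assume that $\mathcal A$ has the comparison property, the linearization property, the lower-bound property and the estimate property described in the context. Assume also that $\frac{\partial u}{\partial t}=D^\alpha_\theta u+f(u)$ has a traveling wave solution $(U,c)$ satisfying $$U\in C^1(\mathbb{R}),\quad \lim_{\xi\to-\infty}U(\xi)=0,\quad \lim_{\xi\to+\infty}U(\xi)=1,\quad U'(\xi)>0\ \text{on }\mathbb{R},\quad \lim_{|\xi|\to\infty}U'(\xi)=0,$$ and let $$0<\delta\le\min\Big\{\min\{1,1/\sigma^*\}\frac{\delta_*}{2},\ \frac{a^-}{2},\ \frac{1-a^+}{2}\Big\},$$ with $\delta_*,\sigma^*$ as in the context. Then there exists a constant $\kappa>0$ such that for any $u_0\in C_b(\mathbb{R})$ satisfying $0\le u_0\le1$ and $$\liminf_{x\to+\infty}u_0(x)>1-\delta>a^+,\qquad \limsup_{x\to-\infty}u_0(x)<\delta<a^-,$$ the solution $u(x,t)$ of $\frac{\partial u}{\partial t}=D^\alpha_\theta u+f(u)$ with $u(\cdot,0)=u_0(\cdot)$ satisfies $$\|u(\cdot,t)-U(\cdot-ct+\xi)\|_{L^\infty(\mathbb{R})}\le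 Ke^{-\kappa t}\qquad\text{for all }t\ge0,$$ where $\xi$ and $K$ are constants depending on $u_0$.
   Context: $C_b$, $C^k_b$: bounded continuous functions, and functions with bounded continuous derivatives up to order $k$. For $1<\alpha<2$ set $c_1=\frac{\Gamma(1+\alpha)\sin((\alpha+\theta)\pi/2)}{\pi}$, $c_2=\frac{\Gamma(1+\alpha)\sin((\alpha-\theta)\pi/2)}{\pi}$ and, for $g\in C_b^2(\mathbb{R})$, $$D^\alpha_\theta g(x)=c_1\int_0^\infty\frac{g(x+\xi)-g(x)-g'(x)\xi}{\xi^{1+\alpha}}\,d\xi+c_2\int_0^\infty\frac{g(x-\xi)-g(x)+g'(x)\xi}{\xi^{1+\alpha}}\,d\xi;$$ for $\alpha=2$ (so $\theta=0$) $D^2_0g=g''$. The linearization of $\mathcal A$ is $\mathcal A'[u](v)=D^\alpha_\theta v+f'(u)v$. A traveling wave solution $(U,c)$ is a profile $U\in C_b^2(\mathbb{R})$ and $c\in\mathbb{R}$ with $-cU'=D^\alpha_\theta U+f(U)$. Solutions with initial datum $u_0$ are functions $u\in C_b(\mathbb{R}\times[0,T])\cap C_b^2(\mathbb{R}\times(t_0,T])$ for all $0<t_0<T<\infty$ satisfying the equation for $t>0$ and $u(\cdot,0)=u_0$; functions satisfying $\partial_tw\ge\mathcal A[w]$ (supersolution) or $\partial_tw\le\mathcal A[w]$ (subsolution) are understood in the same regularity class. Properties of $\mathcal A$: - Comparison property: if $\partial_tu\ge\mathcal A[u]$, $\partial_tv\le\mathcal A[v]$, $u(\cdot,0)\ge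 v(\cdot,0)$ and $u(\cdot,0)\not\equiv v(\cdot,0)$, then $u(\cdot,t)>v(\cdot,t)$ for all $t>0$. - Linearization property: there are constants $K_1,K_2>0$ and a probability measure $\nu$ such that for all functions $u,v$ with $-1\le u,v\le2$ and every $x$, $|\mathcal A'[u+v](1)(x)-\mathcal A'[u](1)(x)|\le K_1\int_{\mathbb{R}}|v(x-y)|\,\nu(dy)+K_2\|v(x+\cdot)\|_{C^0([-1,1])}$. - Lower-bound property: there is a positive non-increasing function $\eta$ on $[1,\infty)$ such that for all $u,v$ with $-1\le u,v\le2$, $\partial_tu\ge\mathcal A[u]$, $\partial_tv\le\mathcal A[v]$, $u(\cdot,0)\ge v(\cdot,0)$: $\min_{x\in[-m,m]}[u(x,1)-v(x,1)]\ge\eta(m)\int_0^1[u(y,0)-v(y,0)]\,dy$ for all $m\ge1$. - Estimate property: there are positive constants $K_1,\dots,K_4$ such that for $-1\le u,v\le2$ (with $u,v\in C_b^2$ where $D^\alpha_\theta$ is applied) and $x\in\mathbb{R}$: $|\mathcal A[u+v](x)-\mathcal A[u](x)|\le K_1|v(x)|+K_2\|v''\|_{C_b(\mathbb{R})}+K_4\|v'\|_{C_b(\mathbb{R})}$, $|\mathcal A[u+v]-\mathcal A[u]-\mathcal A'[u](v)|\le K_3\|v\|^2_{C_b(\mathbb{R})}$, and $|\mathcal A'[u+v](1)(x)-\mathcal A'[u](1)(x)|\le K_1|v(x)|$. Constants $\delta_*,\sigma^*$: with $\beta=\frac12\min\{-f'(0),-f'(1)\}$, $\delta_*>0$ (small,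 independent of $U$) and $\sigma^*>0$ (large, depending on $U$) are constants such that for every $\delta\in(0,\delta_*]$ and $\xi_0\in\mathbb{R}$ the functions $w^\pm(x,t)=U\big(x-ct+\xi_0\pm\sigma^*\delta[1-e^{-\beta t}]\big)\pm\delta e^{-\beta t}$ are a supersolution ($+$) and a subsolution ($-$) of the equation. *)

(* Defs.v *)
From HB Require Import structures.
From mathcomp Require Import all_boot all_order all_algebra.
From mathcomp Require Import all_classical all_reals all_analysis.

Set Implicit Arguments.
Unset Strict Implicit.
Unset Printing Implicit Defensive.

Import Order.TTheory GRing.Theory Num.Theory.
Import numFieldNormedType.Exports.

Local Open Scope ring_scope.
Local Open Scope classical_set_scope.

Definition smooth (R : realType) (f : R -> R) : Prop :=
  forall (n : nat) (x : R), derivable (derive1n n f) x 1.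

Definition Cb (R : realType) (g : R -> R) : Prop :=
  continuous g /\ bounded_fun g.

Definition Cbk (R : realType) (k : nat) (g : R -> R) : Prop :=
  (forall i : nat, (i < k)%N -> forall x, derivable (derive1n i g) x 1) /\
  (forall i : nat, (i <= k)%N -> Cb (derive1n i g)).

(* The usual norm only when g is bounded on A: [sup] of an unbounded set is 0. *)
Definition supnorm (R : realType) (A : set R) (g : R -> R) : R :=
  sup [set `|g x| | x in A].

Definition between (R : realType) (a b : R) (g : R -> R) : Prop :=
  forall x, a <= g x <= b.

(* Functions of space and time are written curried, [w x t]; only their values
   at times [0 <= t] are ever constrained or used. *)

Definition partial_x (R : realType) (w : R -> R -> R) (x t : R) : R :=
  derive1 (w^~ t) x.

Definition partial_t (R : realType) (w : R -> R -> R) (x t : R) : R :=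
  derive1 (w x) t.

Definition Cb_on (R : realType) (Om : set (R * R)) (w : R -> R -> R) : Prop :=
  {within Om, continuous (fun p : R * R => w p.1 p.2)} /\
  [bounded w p.1 p.2 | p in Om].

(* All partial derivatives of order at most k, mixed ones included, exist at
   the points of Om and are bounded and continuous on Om. *)
Fixpoint Cbk_on (R : realType) (k : nat) (Om : set (R * R))
    (w : R -> R -> R) : Prop :=
  Cb_on Om w /\
  match k with
  | 0%N => True
  | k'.+1 =>
      (forall x t, Om (x, t) ->
         derivable (w^~ t) x 1 /\ derivable (w x) t 1) /\
      Cbk_on k' Om (partial_x w) /\ Cbk_on k' Om (partial_t w)
  end.

(* The time derivatives at the endpoint t = T are two-sided; since T ranges over
   all positive numbers this is the same class as with one-sided ones. *)
Definition regular (R : realType) (w : R -> R -> R) : Prop :=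
  forall t0 T : R, 0 < t0 -> t0 < T ->
    Cb_on [set p : R * R | 0 <= p.2 <= T] w /\
    Cbk_on 2 [set p : R * R | t0 < p.2 <= T] w.

Definition Gamma (R : realType) (s : R) : R :=
  \int[lebesgue_measure]_(t in `]0, +oo[) (t `^ (s - 1) * expR (- t)).

Definition c1 (R : realType) (alpha theta : R) : R :=
  Gamma (1 + alpha) * sin ((alpha + theta) * pi / 2) / pi.

Definition c2 (R : realType) (alpha theta : R) : R :=
  Gamma (1 + alpha) * sin ((alpha - theta) * pi / 2) / pi.

(* The Lebesgue integrals converge absolutely when 1 < alpha < 2 and g is in
   C_b^2; outside that class the real-valued integral is a default value. *)
Definition Dfrac (R : realType) (alpha theta : R) (g : R -> R) (x : R) : R :=
  if alpha == 2 then derive1n 2 g x else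
  c1 alpha theta *
    (\int[lebesgue_measure]_(y in `]0, +oo[)
       ((g (x + y) - g x - derive1 g x * y) / y `^ (1 + alpha))) +
  c2 alpha theta *
    (\int[lebesgue_measure]_(y in `]0, +oo[)
       ((g (x - y) - g x + derive1 g x * y) / y `^ (1 + alpha))).

Definition opA (R : realType) (alpha theta : R) (f : R -> R)
    (g : R -> R) (x : R) : R :=
  Dfrac alpha theta g x + f (g x).

Definition opA' (R : realType) (alpha theta : R) (f : R -> R)
    (g v : R -> R) (x : R) : R :=
  Dfrac alpha theta v x + derive1 f (g x) * v x.

Definition supersolution (R : realType) (alpha theta : R) (f : R -> R)
    (w : R -> R -> R) : Prop :=
  regular w /\
  forall x t, 0 < t -> partial_t w x t >= opA alpha theta f (w^~ t) x.

Definition subsolution (R : realType) (alpha theta : R) (f : R -> R)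
    (w : R -> R -> R) : Prop :=
  regular w /\
  forall x t, 0 < t -> partial_t w x t <= opA alpha theta f (w^~ t) x.

Definition solution (R : realType) (alpha theta : R) (f : R -> R)
    (u0 : R -> R) (u : R -> R -> R) : Prop :=
  [/\ regular u,
      forall x t, 0 < t -> partial_t u x t = opA alpha theta f (u^~ t) x
    & forall x, u x 0 = u0 x].

Definition traveling_wave (R : realType) (alpha theta : R) (f : R -> R)
    (U : R -> R) (c : R) : Prop :=
  Cbk 2 U /\ forall x, - c * derive1 U x = opA alpha theta f U x.

Definition comparison_property (R : realType) (alpha theta : R)
    (f : R -> R) : Prop :=
  forall u v : R -> R -> R,
    supersolution alpha theta f u -> subsolution alpha theta f v ->
    (forall x, v x 0 <= u x 0) -> (exists x, u x 0 != v x 0) ->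
    forall x t, 0 < t -> v x t < u x t.

(* u and v are bounded continuous, so that the C^0 norm and the nu-integral on the
   right-hand side make sense. *)
Definition linearization_property (R : realType) (alpha theta : R)
    (f : R -> R) : Prop :=
  exists (K1 K2 : R) (nu : probability (measurableTypeR R) R),
    [/\ 0 < K1, 0 < K2 &
    forall u v : R -> R, Cb u -> Cb v -> between (-1) 2 u -> between (-1) 2 v ->
    forall x,
      `|opA' alpha theta f (u \+ v) (cst 1) x
        - opA' alpha theta f u (cst 1) x|
      <= K1 * (\int[nu]_(y in setT) `|v (x - y)|)
         + K2 * supnorm `[-1, 1] (fun y => v (x + y))].

(* The lower bound on the minimum over [-m, m] is stated at each of its points. *)
Definition lower_bound_property (R : realType) (alpha theta : R)
    (f : R -> R) : Prop :=
  exists eta : R -> R,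
    [/\ forall m, 1 <= m -> 0 < eta m,
        forall m n, 1 <= m -> m <= n -> eta n <= eta m &
    forall u v : R -> R -> R,
      (forall x t, 0 <= t -> -1 <= u x t <= 2) ->
      (forall x t, 0 <= t -> -1 <= v x t <= 2) ->
      supersolution alpha theta f u -> subsolution alpha theta f v ->
      (forall x, v x 0 <= u x 0) ->
      forall m, 1 <= m -> forall x, - m <= x <= m ->
        eta m * (\int[lebesgue_measure]_(y in `[0, 1]) (u y 0 - v y 0))
        <= u x 1 - v x 1].

Definition estimate_property (R : realType) (alpha theta : R)
    (f : R -> R) : Prop :=
  exists K1 K2 K3 K4 : R,
    [/\ 0 < K1, 0 < K2, 0 < K3 & 0 < K4] /\
    (forall u v : R -> R, Cbk 2 u -> Cbk 2 v ->
       between (-1) 2 u -> between (-1) 2 v ->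
       forall x,
         `|opA alpha theta f (u \+ v) x - opA alpha theta f u x|
           <= K1 * `|v x| + K2 * supnorm setT (derive1n 2 v)
              + K4 * supnorm setT (derive1 v) /\
         `|opA alpha theta f (u \+ v) x - opA alpha theta f u x
           - opA' alpha theta f u v x|
           <= K3 * supnorm setT v ^+ 2) /\
    (forall u v : R -> R, Cb u -> Cb v ->
       between (-1) 2 u -> between (-1) 2 v ->
       forall x,
         `|opA' alpha theta f (u \+ v) (cst 1) x
           - opA' alpha theta f u (cst 1) x| <= K1 * `|v x|).

Definition beta_rate (R : realType) (f : R -> R) : R :=
  2^-1 * Num.min (- derive1 f 0) (- derive1 f 1).

Definition wplus (R : realType) (f U : R -> R) (c sstar delta xi0 : R)
    (x t : R) : R :=
  U (x - c * t + xi0 + sstar * delta * (1 - expR (- beta_rate f * t)))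
  + delta * expR (- beta_rate f * t).

Definition wminus (R : realType) (f U : R -> R) (c sstar delta xi0 : R)
    (x t : R) : R :=
  U (x - c * t + xi0 - sstar * delta * (1 - expR (- beta_rate f * t)))
  - delta * expR (- beta_rate f * t).

Definition barrier_constants (R : realType) (alpha theta : R) (f U : R -> R)
    (c dstar sstar : R) : Prop :=
  [/\ 0 < dstar, 0 < sstar &
  forall delta xi0 : R, 0 < delta <= dstar ->
    supersolution alpha theta f (wplus f U c sstar delta xi0) /\
    subsolution alpha theta f (wminus f U c sstar delta xi0)].

(* Main.v *)
Require Import Defs.
From HB Require Import structures.
From mathcomp Require Import all_boot all_order all_algebra.
From mathcomp Require Import all_classical all_reals all_analysis.
From mathcomp Require Import ess_sup_inf ring lra.

Import Order.TTheory GRing.Theory Num.Theory.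
Import numFieldNormedType.Exports.

Local Open Scope ring_scope.
Local Open Scope classical_set_scope.

Set Implicit Arguments.
Unset Strict Implicit.
Unset Printing Implicit Defensive.

(** The proof is a squeezing argument.  A solution with values in [0, 1] that
    lies between two translates of the wave,
      [U (x - c * t + a) - d <= u x t <= U (x - c * t + a + h) + d],
    stays trapped in this way, because the barriers [wminus] and [wplus] are a
    sub- and a supersolution: after a while the vertical error [d] has decayed
    like [expR (- beta * t)], at the price of widening the horizontal gap [h] by
    [2 * sstar * d] ([trapped_later]).  So only the gap has to be reduced.

    On the unit interval the two translates enclose a mass of order [h].  Hence
    one of them is at distance of order [h], in mean, from [u]
    ([mass_dichotomy]), and the lower-bound property turns this into a uniform
    distance on a large window one unit of time later.  There the corresponding
    translate can be moved towards [u] by a small multiple of [h].  Outside the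
    window the wave is flat, and moving it costs a vertical error which is only
    a fraction of the displacement and decays again ([squeeze_gain]).  If [d] is
    a small enough multiple of [h], the displacement wins over the widening, and
    after a fixed time both [h] and [d] have shrunk by a fixed factor
    ([squeeze_step]).  Iterating, the intervals in which the phase is located
    are nested and shrink geometrically; their common point is [xi]
    ([squeeze_converges]).

    The factor depends on the initial gap [H].  That is why the iteration is run
    twice: first with the gap of the datum at hand, until the gap is below 1
    ([trapped_eventually]), then with [H = 1], which gives a rate [kappa]
    depending on the wave only ([wave_stability]).  The hypotheses on the
    behaviour of the datum at infinity are what traps it at time 0
    ([trapped_initially]).  To choose [xi] and [K] from the datum rather than
    from the solution, the lower-bound property is used once more: two solutions
    with the same datum agree at all integer times ([trajectories_agree]), and
    the whole iteration is carried out at integer times. *)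

(** * Real sequences, integrals and norms *)

Lemma expR_decay (R : realType) (b e : R) : 0 < b -> 0 < e ->
  exists n : nat, expR (- b * n%:R) <= e.
Proof.
move=> b0 e0; exists (Num.truncn (e^-1 / b)).+1.
have ht : e^-1 / b < (Num.truncn (e^-1 / b)).+1%:R by exact: truncnS_gt.
rewrite mulNr expRN -[leRHS]invrK lef_pV2 ?posrE ?expR_gt0 ?invr_gt0//.
rewrite ltr_pdivrMr// mulrC in ht.
have := expR_ge1Dx (b * (Num.truncn (e^-1 / b)).+1%:R); lra.
Qed.

Lemma geometric_decay (R : realType) (rho e : R) : 0 < rho < 1 -> 0 < e ->
  exists n : nat, rho ^+ n <= e.
Proof.
move=> /[dup] rho01 /andP[r0 _] e0; have lr := ln_lt0 rho01.
have [|n hn] := expR_decay (b := - ln rho) _ e0; first by rewrite oppr_gt0.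
by exists n; rewrite opprK mulrC expRM_natl lnK ?posrE in hn.
Qed.

Lemma nested_intervals (R : realType) (A B : nat -> R) :
  (forall n, A n <= A n.+1) ->
  (forall n, B n.+1 <= B n) -> (forall n, A n <= B n) ->
  exists xi, forall n, A n <= xi <= B n.
Proof.
move=> /nondecreasing_seqP A1 /nonincreasing_seqP B1 AB.
have ABmn m n : A m <= B n.
  apply: (le_trans (A1 _ _ (leq_maxl m n))); apply: (le_trans (AB _)).
  by apply: B1; exact: leq_maxr.
have hs : has_sup (range A).
  by split; [exists (A 0%N), 0%N|exists (B 0%N) => _ [n _ <-]].
exists (sup (range A)) => n; apply/andP; split.
  by apply: sup_upper_bound => //; exists n.
by apply: ge_sup; [exists (A 0%N), 0%N|move=> _ [m _ <-]].
Qed.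

(** The two integrals add up to that of [w2 - w1], whatever [v] is. *)
Lemma mass_dichotomy (R : realType) (v w1 w2 : R -> R) (e : R) :
  continuous v -> continuous w1 -> continuous w2 ->
  (forall y, 0 <= y <= 1 -> 2 * e <= w2 y - w1 y) ->
  e <= \int[lebesgue_measure]_(y in `[0, 1]) (v y - w1 y) \/
  e <= \int[lebesgue_measure]_(y in `[0, 1]) (w2 y - v y).
Proof.
move=> cv c1 c2 w12.
have halve (a b : R) : 2 * e <= a + b -> a < e -> e <= b by lra.
have int (g h : R -> R) : continuous g -> continuous h ->
    (@lebesgue_measure R).-integrable `[0, 1] (EFin \o (fun y => g y - h y)).
  move=> cg ch; apply: continuous_compact_integrable; first exact: segment_compact.
  by apply: continuous_subspaceT => x; apply: cvgB; [exact: cg|exact: ch].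
have m01 : measurable (`[0, 1] : set (measurableTypeR R)) by exact: measurable_itv.
have icst : (@lebesgue_measure R).-integrable `[0, 1] (EFin \o (fun _ : R => 2 * e)).
  apply: continuous_compact_integrable; first exact: segment_compact.
  by apply: continuous_subspaceT => x; exact: cvg_cst.
have : \int[lebesgue_measure]_(y in `[0, 1]) (2 * e) <=
    \int[lebesgue_measure]_(y in `[0, 1]) ((v y - w1 y) + (w2 y - v y)).
  apply: le_Rintegral => //.
    have -> : (fun y => (v y - w1 y) + (w2 y - v y)) = (fun y => w2 y - w1 y).
      by apply/funext => y; ring.
    exact: int.
  move=> y /=; rewrite in_itv /= => /w12; lra.
rewrite RintegralD//; [|exact: int|exact: int].
have mu01 : @lebesgue_measure R `[0, 1] = 1%:E.
  by rewrite lebesgue_measure_itv /= lte_fin ltr01 -EFinB subr0.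
have -> : \int[lebesgue_measure]_(y in `[0, 1]) (2 * e) = 2 * e.
  by rewrite Rintegral_cst//; rewrite [X in fine X](_ : _ = 1%:E) ?mulr1.
move=> h; have [?|I1] := leP e (\int[lebesgue_measure]_(y in `[0, 1]) (v y - w1 y)).
  by left.
by right; exact: halve h I1.
Qed.

Lemma Lnormy_le (R : realType) (g : R -> R) (K : R) :
  (forall x, `|g x| <= K) ->
  ('N[(@lebesgue_measure R)]_+oo [(fun x : R => (g x)%:E)] <= K%:E)%E.
Proof.
move=> gK; rewrite unlock; case: ifP => _; last first.
  by rewrite lee_fin (le_trans _ (gK 0)).
by apply/ess_supP; apply: nearW => x /=; rewrite lee_fin.
Qed.

Lemma liminf_pinfty_gt (R : realType) (g : R -> R) (m : R) :
  (m%:E < limf_einf (EFin \o g) (pinfty_nbhs R))%E ->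
  exists X, forall x, X < x -> m < g x.
Proof.
rewrite limf_einfE => /ereal_sup_gt[_ [V [X [_ XV]] <-] mV].
exists X => x /XV Vx; rewrite -lte_fin (lt_le_trans mV)//.
by apply: ereal_inf_lbound; exists x.
Qed.

Lemma limsup_ninfty_lt (R : realType) (g : R -> R) (m : R) :
  (limf_esup (EFin \o g) (ninfty_nbhs R) < m%:E)%E ->
  exists X, forall x, x < X -> g x < m.
Proof.
rewrite limf_esupE => /ereal_inf_lt[_ [V [X [_ XV]] <-] mV].
exists X => x /XV Vx; rewrite -lte_fin (le_lt_trans _ mV)//.
by apply: ereal_sup_ubound; exists x.
Qed.

(** * Translations and equilibria *)

Section Translation.
Variable R : realType.
Implicit Types (g : R -> R) (w u v : R -> R -> R) (a tau x t : R).

Lemma derive1_translate g a x :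
  derive1 (fun y => g (y + a)) x = derive1 g (x + a).
Proof. by rewrite /derive1; under eq_fun do rewrite -addrA. Qed.

Lemma derivable_translate g a x :
  derivable g (x + a) 1 -> derivable (fun y => g (y + a)) x 1.
Proof.
rewrite /derivable /= => dg.
by under eq_fun do rewrite -addrA.
Qed.

Definition translate w a tau : R -> R -> R := fun x t => w (x + a) (t + tau).

Lemma partial_x_translate w a tau :
  partial_x (translate w a tau) = translate (partial_x w) a tau.
Proof.
apply/funext => x; apply/funext => t.
exact: (derive1_translate (w^~ (t + tau))).
Qed.

Lemma partial_t_translate w a tau :
  partial_t (translate w a tau) = translate (partial_t w) a tau.
Proof.
apply/funext => x; apply/funext => t.
exact: (derive1_translate (w (x + a))).
Qed.

Section Domains.
Variables (a tau : R) (Om Om' : set (R * R)).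
Hypothesis sub : forall x t, Om' (x, t) -> Om (x + a, t + tau).

Lemma Cb_on_translate w : Cb_on Om w -> Cb_on Om' (translate w a tau).
Proof.
move=> [cw bw]; split; last first.
  have [M [Mr HM]] := bw; exists M; split => // N MN [x t] /= Oxt.
  exact: (HM N MN (x + a, t + tau) (sub Oxt)).
apply/subspace_continuousP => -[x t] /= Oxt.
move/subspace_continuousP : cw => /(_ _ (sub Oxt)) cw.
have ct : (fun p : R * R => (p.1 + a, p.2 + tau)) @ nbhs (x, t)
    --> nbhs (x + a, t + tau).
  have c1 : (fun p : R * R => p.1 + a) @ nbhs (x, t) --> nbhs (x + a).
    by apply: (@cvgD _ R); [exact: cvg_fst|exact: cvg_cst].
  have c2 : (fun p : R * R => p.2 + tau) @ nbhs (x, t) --> nbhs (t + tau).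
    by apply: (@cvgD _ R); [exact: cvg_snd|exact: cvg_cst].
  exact: (cvg_pair c1 c2).
have ct' : (fun p : R * R => (p.1 + a, p.2 + tau)) @ within Om' (nbhs (x, t))
    --> within Om (nbhs (x + a, t + tau)).
  move=> B /= /ct /= HB; move: HB; rewrite /nbhs/= /within/=.
  by apply: filterS => -[y s] /= h /sub; exact: h.
exact: (cvg_comp _ _ ct' cw).
Qed.

Lemma Cbk_on_translate k w : Cbk_on k Om w -> Cbk_on k Om' (translate w a tau).
Proof.
elim: k w => [|k IH] w /=; first by move=> [cw _]; split=> //; exact: Cb_on_translate.
move=> [cw [dw [dx dt]]]; split; first exact: Cb_on_translate.
rewrite partial_x_translate partial_t_translate; split; last by split; exact: IH.
move=> x t /sub/dw[dx' dt']; split.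
  exact: (derivable_translate dx').
exact: (derivable_translate dt').
Qed.

End Domains.

Lemma regular_translate w a tau : 0 <= tau -> regular w ->
  regular (translate w a tau).
Proof.
move=> tau0 rw t0 T t00 t0T.
have [cw dw] : Cb_on [set p : R * R | 0 <= p.2 <= T + tau] w /\
    Cbk_on 2 [set p : R * R | t0 < p.2 <= T + tau] w by apply: rw; lra.
split.
  by apply: (Cb_on_translate _ cw) => x t /= /andP[? ?]; apply/andP; split; lra.
by apply: (Cbk_on_translate _ dw) => x t /= /andP[? ?]; apply/andP; split; lra.
Qed.

Lemma Cbk_on_cst k (Om : set (R * R)) (b : R) : Cbk_on k Om (fun _ _ => b).
Proof.
have cb d : Cb_on Om (fun _ _ => d).
  split; first by move=> x; exact: cvg_cst.
  by exists `|d|; split=> // M dM x _ /=; exact: ltW.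
elim: k b => [|k IH] b /=; first by split.
have dx : partial_x (fun _ _ => b) = fun _ _ => 0.
  by apply/funext => x; apply/funext => t; exact: derive1_cst.
have dt : partial_t (fun _ _ => b) = fun _ _ => 0.
  by apply/funext => x; apply/funext => t; exact: derive1_cst.
by rewrite dx dt; split=> //; split=> //; split; exact: IH.
Qed.

Lemma regular_cst (b : R) : regular (fun _ _ => b).
Proof.
move=> t0 T _ _; split; last exact: Cbk_on_cst.
by have [] := Cbk_on_cst 0 [set p : R * R | 0 <= p.2 <= T] b.
Qed.

Lemma continuous_slice w t : regular w -> 0 <= t -> continuous (w^~ t).
Proof.
move=> rw t0; have [[cw _] _] : Cb_on [set p : R * R | 0 <= p.2 <= t + 2] w /\
    Cbk_on 2 [set p : R * R | 1 < p.2 <= t + 2] w by apply: rw; lra.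
move=> x; move/subspace_continuousP : cw => /(_ (x, t)) /=.
have -> : 0 <= t <= t + 2 by apply/andP; split; lra.
move=> /(_ isT) cw.
have ct : (fun y : R => (y, t)) @ nbhs x --> nbhs (x, t).
  have c1 : (fun y : R => y) @ nbhs x --> nbhs x by exact: cvg_id.
  have c2 : (fun _ : R => t) @ nbhs x --> nbhs t by exact: cvg_cst.
  exact: (cvg_pair c1 c2).
have ct' : (fun y : R => (y, t)) @ nbhs x
    --> within [set p : R * R | 0 <= p.2 <= t + 2] (nbhs (x, t)).
  move=> B HB; have HB' : nbhs x (fun y => 0 <= t <= t + 2 -> B (y, t)) :=
    ct _ HB.
  by apply: (filterS _ HB') => y; apply; apply/andP; split; lra.
exact: (cvg_comp _ _ ct' cw).
Qed.

Variables (alpha theta : R) (f : R -> R).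

Lemma Dfrac_translate g a x :
  Dfrac alpha theta (fun y => g (y + a)) x = Dfrac alpha theta g (x + a).
Proof.
have d1 : derive1 (fun y => g (y + a)) = fun y => derive1 g (y + a).
  by apply/funext => y; exact: derive1_translate.
rewrite /Dfrac d1; case: (alpha == 2).
  by rewrite /derive1n /= d1 (derive1_translate (derive1 g)).
have e1 : \int[lebesgue_measure]_(y in `]0, +oo[)
       ((g (x + y + a) - g (x + a) - derive1 g (x + a) * y) / y `^ (1 + alpha)) =
  \int[lebesgue_measure]_(y in `]0, +oo[)
       ((g (x + a + y) - g (x + a) - derive1 g (x + a) * y) / y `^ (1 + alpha)).
  by apply: eq_Rintegral => y _; rewrite (addrAC x).
have e2 : \int[lebesgue_measure]_(y in `]0, +oo[)
       ((g (x - y + a) - g (x + a) + derive1 g (x + a) * y) / y `^ (1 + alpha)) =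
  \int[lebesgue_measure]_(y in `]0, +oo[)
       ((g (x + a - y) - g (x + a) + derive1 g (x + a) * y) / y `^ (1 + alpha)).
  by apply: eq_Rintegral => y _; rewrite (addrAC x).
by rewrite e1 e2.
Qed.

Lemma Dfrac_cst (b x : R) : Dfrac alpha theta (fun _ => b) x = 0.
Proof.
have d0 : derive1 (fun _ : R => b) = fun _ => 0.
  by apply/funext => y; exact: derive1_cst.
rewrite /Dfrac; case: ifP => _; first by rewrite /derive1n /= d0 derive1_cst.
rewrite d0 /Rintegral !integral0_eq ?mulr0 ?addr0// => y _;
  by rewrite mul0r subrr ?addr0 ?subr0 mul0r.
Qed.

Lemma supersolution_translate w a tau : 0 <= tau ->
  supersolution alpha theta f w ->
  supersolution alpha theta f (translate w a tau).
Proof.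
move=> tau0 [rw sw]; split; first exact: regular_translate.
move=> x t t0; rewrite partial_t_translate /opA.
rewrite (Dfrac_translate (w^~ (t + tau))); apply: sw; lra.
Qed.

Lemma subsolution_translate w a tau : 0 <= tau ->
  subsolution alpha theta f w ->
  subsolution alpha theta f (translate w a tau).
Proof.
move=> tau0 [rw sw]; split; first exact: regular_translate.
move=> x t t0; rewrite partial_t_translate /opA.
rewrite (Dfrac_translate (w^~ (t + tau))); apply: sw; lra.
Qed.

Lemma equilibrium_solution b : f b = 0 ->
  supersolution alpha theta f (fun _ _ => b) /\
  subsolution alpha theta f (fun _ _ => b).
Proof.
move=> fb; have e x t : partial_t (fun _ _ : R => b) x t =
    opA alpha theta f (fun _ => b) x.
  by rewrite /opA Dfrac_cst fb addr0; exact: derive1_cst.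
by split; (split; first exact: regular_cst) => x t _; rewrite e.
Qed.

(** The class of solutions on which the squeezing argument is run: unlike the
    solutions from a given datum, it is stable under translations. *)
Definition trajectory u :=
  [/\ supersolution alpha theta f u, subsolution alpha theta f u
    & forall x t, 0 <= t -> 0 <= u x t <= 1].

Lemma trajectory_translate u a tau : 0 <= tau -> trajectory u ->
  trajectory (translate u a tau).
Proof.
move=> tau0 [su bu u01]; split.
- exact: supersolution_translate.
- exact: subsolution_translate.
- by move=> x t t0; apply: u01; lra.
Qed.

(** The equilibria 0 and 1 confine the solution; its datum differs from both, as
    the comparison property requires. *)
Lemma solution_trajectory (u0 : R -> R) u : comparison_property alpha theta f ->
  f 0 = 0 -> f 1 = 0 -> (forall x, 0 <= u0 x <= 1) ->
  (exists x, u0 x != 0) -> (exists x, u0 x != 1) ->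
  solution alpha theta f u0 u -> trajectory u.
Proof.
move=> cmp f0 f1 u01 [y y0] [z z1] [ru eu ui].
have su : supersolution alpha theta f u by split=> // x t t0; rewrite eu.
have bu : subsolution alpha theta f u by split=> // x t t0; rewrite eu.
split=> // x t; rewrite le_eqVlt => /predU1P[<-|t0]; first by rewrite ui.
have [[s0 b0] [s1 b1]] := (equilibrium_solution f0, equilibrium_solution f1).
apply/andP; split.
  apply/ltW/(cmp _ _ su b0) => //.
    by move=> r; rewrite ui; case/andP: (u01 r).
  by exists y; rewrite ui.
apply/ltW/(cmp _ _ s1 bu) => //.
  by move=> r; rewrite ui; case/andP: (u01 r).
by exists z; rewrite ui eq_sym.
Qed.

End Translation.

(** * The profile *)

Section Wave.
Variables (R : realType) (alpha theta : R) (f U : R -> R) (c dstar sstar : R).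
Hypothesis cmp : comparison_property alpha theta f.
Hypothesis low : lower_bound_property alpha theta f.
Hypothesis U2 : Cbk 2 U.
Hypothesis U0 : U @ -oo --> (0 : R).
Hypothesis U1 : U @ +oo --> (1 : R).
Hypothesis dU_gt0 : forall x, 0 < derive1 U x.
Hypothesis dU0 : derive1 U @ -oo --> (0 : R).
Hypothesis dU1 : derive1 U @ +oo --> (0 : R).
Hypothesis bar : barrier_constants alpha theta f U c dstar sstar.
Hypothesis beta_gt0 : 0 < beta_rate f.

Local Notation beta := (beta_rate f).
Local Notation trajectory := (trajectory alpha theta f).

Let dstar_gt0 : 0 < dstar. Proof. by case: bar. Qed.
Let sstar_gt0 : 0 < sstar. Proof. by case: bar. Qed.

Lemma wave_derivable x : derivable U x 1.
Proof. by have [dU _] := U2; exact: (dU 0%N). Qed.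

Lemma wave_continuous : continuous U.
Proof. by have [_ /(_ 0%N isT)[]] := U2. Qed.

Lemma wave_derive_continuous : continuous (derive1 U).
Proof. by have [_ /(_ 1%N isT)[]] := U2. Qed.

Lemma wave_MVT x y : x <= y ->
  exists2 z, x <= z <= y & U y - U x = derive1 U z * (y - x).
Proof.
move=> xy; have dr z : z \in `]x, y[%R -> is_derive z 1 U (derive1 U z).
  by move=> _; rewrite derive1E; apply: DeriveDef => //; exact: wave_derivable.
have [z zxy e] := MVT_segment xy dr (continuous_subspaceT wave_continuous).
by exists z => //; move: zxy; rewrite in_itv.
Qed.

Lemma wave_lt x y : x < y -> U x < U y.
Proof.
move=> xy; have [z _ e] := wave_MVT (ltW xy).
by rewrite -subr_gt0 e mulr_gt0// subr_gt0.
Qed.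

Lemma wave_le x y : x <= y -> U x <= U y.
Proof. by rewrite le_eqVlt => /predU1P[->//|/wave_lt/ltW]. Qed.

Lemma wave_small e : 0 < e -> exists r, U r < e.
Proof.
move=> e0; have [A [_ HA]] := cvgr_lt _ U0 _ e0.
by exists (A - 1); apply: HA; rewrite ltrBlDr ltrDl.
Qed.

Lemma wave_large e : e < 1 -> exists r, e < U r.
Proof.
move=> e1; have [A [_ HA]] := cvgr_gt _ U1 _ e1.
by exists (A + 1); apply: HA; rewrite ltrDl.
Qed.

Lemma wave_gt0 x : 0 < U x.
Proof.
apply: le_lt_trans (wave_lt (_ : x - 1 < x)); last lra.
rewrite leNgt; apply/negP => Ux.
have [A [_ HA]] := cvgr_gt _ U0 _ Ux.
have m1 : Num.min A (x - 1) <= A by rewrite ge_min lexx.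
have m2 : Num.min A (x - 1) <= x - 1 by rewrite ge_min lexx orbT.
have : U (Num.min A (x - 1) - 1) <= U (x - 1) by apply: wave_le; lra.
have : U (x - 1) < U (Num.min A (x - 1) - 1) by apply: HA; lra.
lra.
Qed.

Lemma wave_lt1 x : U x < 1.
Proof.
apply: lt_le_trans (wave_lt (_ : x < x + 1)) _; first lra.
rewrite leNgt; apply/negP => Ux.
have [A [_ HA]] := cvgr_lt _ U1 _ Ux.
have m1 : A <= Num.max A (x + 1) by rewrite le_max lexx.
have m2 : x + 1 <= Num.max A (x + 1) by rewrite le_max lexx orbT.
have : U (x + 1) <= U (Num.max A (x + 1) + 1) by apply: wave_le; lra.
have : U (Num.max A (x + 1) + 1) < U (x + 1) by apply: HA; lra.
lra.
Qed.

Lemma wave_slope_bounded : exists2 M, 0 < M & forall x, derive1 U x <= M.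
Proof.
have [_ /(_ 1%N isT)[_ [M [_ HM]]]] := U2.
exists (`|M| + 1) => [|x]; first by rewrite ltr_wpDl.
apply: (le_trans (ler_norm _)); apply: (HM (`|M| + 1)) => //.
by rewrite (le_lt_trans (ler_norm _))// ltrDl.
Qed.

Lemma wave_flat e : 0 < e ->
  exists2 r, 0 < r & forall x, r <= `|x| -> derive1 U x <= e.
Proof.
move=> e0; have [A [_ HA]] := cvgr_lt _ dU0 _ e0.
have [B [_ HB]] := cvgr_lt _ dU1 _ e0.
exists (`|A| + `|B| + 1) => [|x]; first by rewrite ltr_wpDl// addr_ge0.
have := ler_norm A; have := ler_norm B; have := ler_norm (- A).
have := normr_ge0 A; have := normr_ge0 B; rewrite normrN => A0 B0 lA lB lA' xr.
have [x0|x0] := leP 0 x.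
  by apply/ltW/HB; move: xr; rewrite (ger0_norm x0); lra.
by apply/ltW/HA; move: xr; rewrite (ltr0_norm x0); lra.
Qed.

Lemma wave_slope_min h : 0 <= h ->
  exists2 e, 0 < e & forall x, 0 <= x <= h -> e <= derive1 U x.
Proof.
move=> h0; have [z _ zm] := EVT_min h0 (continuous_subspaceT wave_derive_continuous).
by exists (derive1 U z) => // x xh; exact: zm.
Qed.

Lemma wave_increment q x y : x <= y ->
  (forall z, x <= z <= y -> derive1 U z <= q) -> U y <= U x + q * (y - x).
Proof.
move=> xy hq; have [z zxy e] := wave_MVT xy.
have : derive1 U z * (y - x) <= q * (y - x).
  by rewrite ler_wpM2r ?subr_ge0// hq.
lra.
Qed.

(** Shifting the wave by [k] raises it by at most [M * k], which the gap [g]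
    absorbs on the window [-m, m].  For [x] outside the window, the values of
    the wave involved are taken at distance at least [r] from the origin, where
    the slope is at most [q]. *)
Lemma shift_up (v : R -> R) b k p g q r m M : 0 <= k ->
  (forall z, derive1 U z <= M) -> M * k <= g ->
  (forall z, r <= `|z| -> derive1 U z <= q) -> 0 <= q -> `|b| + k + r <= m ->
  (forall x, U (x + b) - p <= v x) ->
  (forall x, - m <= x <= m -> U (x + b) - p + g <= v x) ->
  forall x, U (x + b + k) - (p + q * k) <= v x.
Proof.
move=> k0 hM Mg hq q0 bm v1 v2 x.
have qk : 0 <= q * k by exact: mulr_ge0.
have le : x + b <= x + b + k by rewrite lerDl.
have [xm|xm] := leP `|x| m.
  have := wave_increment le (fun z _ => hM z).
  by rewrite ler_norml in xm; have := v2 _ xm; lra.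
have : U (x + b + k) <= U (x + b) + q * (x + b + k - (x + b)).
  apply: wave_increment => // z /andP[z1 z2]; apply: hq.
  have : `|x| <= `|z| + `|b| + k; last lra.
  have := ler_norm b; have := ler_norm (- b); rewrite normrN.
  have := ler_norm z; have := ler_norm (- z); rewrite normrN.
  by move=> *; rewrite ler_norml; apply/andP; split; lra.
have := v1 x; lra.
Qed.

Lemma shift_down (v : R -> R) b k p g q r m M : 0 <= k ->
  (forall z, derive1 U z <= M) -> M * k <= g ->
  (forall z, r <= `|z| -> derive1 U z <= q) -> 0 <= q -> `|b| + k + r <= m ->
  (forall x, v x <= U (x + b) + p) ->
  (forall x, - m <= x <= m -> v x <= U (x + b) + p - g) ->
  forall x, v x <= U (x + b - k) + (p + q * k).
Proof.
move=> k0 hM Mg hq q0 bm v1 v2 x.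
have qk : 0 <= q * k by exact: mulr_ge0.
have le : x + b - k <= x + b by rewrite gerBl.
have [xm|xm] := leP `|x| m.
  have := wave_increment le (fun z _ => hM z).
  by rewrite ler_norml in xm; have := v2 _ xm; lra.
have : U (x + b) <= U (x + b - k) + q * (x + b - (x + b - k)).
  apply: wave_increment => // z /andP[z1 z2]; apply: hq.
  have : `|x| <= `|z| + `|b| + k; last lra.
  have := ler_norm b; have := ler_norm (- b); rewrite normrN.
  have := ler_norm z; have := ler_norm (- z); rewrite normrN.
  by move=> *; rewrite ler_norml; apply/andP; split; lra.
have := v1 x; lra.
Qed.

(** * Barriers *)

Lemma expR_beta_bounds t : 0 <= t -> 0 < expR (- beta * t) <= 1.
Proof.
by move=> t0; rewrite expR_gt0 expR_le1 mulNr oppr_le0 mulr_ge0// ltW.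
Qed.

Lemma wminus0 d a x : wminus f U c sstar d a x 0 = U (x + a) - d.
Proof. by rewrite /wminus !mulr0 expR0 subrr mulr0 !subr0 mulr1. Qed.

Lemma wplus0 d a x : wplus f U c sstar d a x 0 = U (x + a) + d.
Proof. by rewrite /wplus !mulr0 expR0 subrr mulr0 subr0 addr0 mulr1. Qed.

Lemma wminus_bounds d a x t : 0 < d <= 1 -> 0 <= t ->
  -1 <= wminus f U c sstar d a x t <= 2.
Proof.
move=> /andP[d0 d1] /expR_beta_bounds/andP[e0 e1]; rewrite /wminus.
set y := (X in U X); have := wave_gt0 y; have := wave_lt1 y.
have : d * expR (- beta * t) <= 1 by rewrite mulr_ile1// ltW.
have : 0 <= d * expR (- beta * t) by rewrite mulr_ge0// ltW.
by move=> *; apply/andP; split; lra.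
Qed.

Lemma wplus_bounds d a x t : 0 < d <= 1 -> 0 <= t ->
  -1 <= wplus f U c sstar d a x t <= 2.
Proof.
move=> /andP[d0 d1] /expR_beta_bounds/andP[e0 e1]; rewrite /wplus.
set y := (X in U X); have := wave_gt0 y; have := wave_lt1 y.
have : d * expR (- beta * t) <= 1 by rewrite mulr_ile1// ltW.
have : 0 <= d * expR (- beta * t) by rewrite mulr_ge0// ltW.
by move=> *; apply/andP; split; lra.
Qed.

Lemma trajectory_bounds u : trajectory u ->
  forall x t, 0 <= t -> -1 <= u x t <= 2.
Proof.
move=> [_ _ u01] x t /(u01 x)/andP[l1 l2]; rewrite (le_trans _ l1) ?lerN10//=.
by rewrite (le_trans l2)// ler1n.
Qed.

(** The comparison property asks for initial data that differ somewhere: they do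
    because [U - d] takes negative values near [-oo], and [u] does not. *)
Lemma barrier_below u a d t : trajectory u -> 0 < d <= dstar -> 0 <= t ->
  (forall x, U (x + a) - d <= u x 0) ->
  forall x, wminus f U c sstar d a x t <= u x t.
Proof.
move=> [su _ u01] dd; rewrite le_eqVlt => /predU1P[<- h x|t0 h x].
  by rewrite wminus0.
have [_ _ /(_ d a dd)[_ sw]] := bar.
apply/ltW/(cmp su sw) => // [y|]; first by rewrite wminus0.
have [r Ur] : exists r, U r < d by apply: wave_small; case/andP: dd.
exists (r - a); rewrite wminus0 subrK gt_eqF//.
by have /andP[+ _] := u01 (r - a) 0 (lexx _); lra.
Qed.

Lemma barrier_above u a d t : trajectory u -> 0 < d <= dstar -> 0 <= t ->
  (forall x, u x 0 <= U (x + a) + d) ->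
  forall x, u x t <= wplus f U c sstar d a x t.
Proof.
move=> [_ su u01] dd; rewrite le_eqVlt => /predU1P[<- h x|t0 h x].
  by rewrite wplus0.
have [_ _ /(_ d a dd)[sw _]] := bar.
apply/ltW/(cmp sw su) => // [y|]; first by rewrite wplus0.
have [r Ur] : exists r, 1 - d < U r by apply: wave_large; case/andP: dd; lra.
exists (r - a); rewrite wplus0 subrK gt_eqF//.
by have /andP[_ +] := u01 (r - a) 0 (lexx _); lra.
Qed.

(** * Squeezing *)

(** With a gap [g] between [u] and the lower barrier on the window at time 1, the
    barrier may be moved by [8 * sstar * d] at the vertical cost [4 * d].
    Restarting the comparison from there takes back at most [5 * sstar * d] of
    the displacement in all, which leaves the net gain [3 * sstar * d]. *)
Lemma raise_below u d r m M g t : trajectory u ->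
  0 < d -> 5 * d <= dstar -> 0 <= t ->
  (forall z, derive1 U z <= M) -> M * (8 * sstar * d) <= g ->
  (forall z, r <= `|z| -> derive1 U z <= (2 * sstar)^-1) ->
  `|c| + 9 * sstar * d + r <= m ->
  (forall x, - m <= x <= m -> wminus f U c sstar d 0 x 1 + g <= u x 1) ->
  (forall x, U x - d <= u x 0) ->
  forall x, U (x - c * (t + 1) + 3 * sstar * d) - 5 * d * expR (- beta * t)
    <= u x (t + 1).
Proof.
move=> tu d0 d5 t0 hM Mg hr hm hg h0 x.
have [dp sp] := (dstar_gt0, sstar_gt0).
have d1 : 0 < d <= dstar by rewrite d0; lra.
have /andP[E0 E1] := expR_beta_bounds (ler01 : 0 <= 1 :> R).
have /andP[F0 F1] := expR_beta_bounds t0.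
set E := expR (- beta * 1) in E0 E1; set F := expR (- beta * t) in F0 F1 *.
have sd : 0 < sstar * d by exact: mulr_gt0.
have sdE : 0 <= sstar * d * E by rewrite mulr_ge0 ?ltW.
have sdE1 : sstar * d * E <= sstar * d by rewrite ler_piMr// ltW.
have dE : 0 <= d * E by rewrite mulr_ge0 ?ltW.
have dE1 : d * E <= d by rewrite ler_piMr// ltW.
pose b := - c - sstar * d * (1 - E).
have wb y : wminus f U c sstar d 0 y 1 = U (y + b) - d * E.
  by rewrite /wminus -/E /b; congr (U _ - _); ring.
pose k := 8 * sstar * d.
have below1 y : U (y + b + k) - (d * E + 4 * d) <= u y 1.
  have -> : 4 * d = (2 * sstar)^-1 * k by rewrite /k; field; exact: lt0r_neq0.
  apply: (@shift_up (u^~ 1) b k (d * E) g (2 * sstar)^-1 r m M) => //.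
  - by rewrite /k; lra.
  - by rewrite invr_ge0; lra.
  - have : `|b| <= `|c| + sstar * d; last by rewrite /k; lra.
    rewrite /b (le_trans (ler_normB _ _))// normrN lerD2l ger0_norm; lra.
  - move=> z; rewrite -wb; apply: barrier_below => // z'.
    by rewrite addr0.
  - by move=> z /hg; rewrite wb.
(* The barrier restarts at time 1 from the shifted wave. *)
have := @barrier_below (translate u 0 1) (b + k) (d * E + 4 * d) t.
move=> /(_ (trajectory_translate _ ler01 tu)) /(_ _ t0).
have -> : 0 < d * E + 4 * d <= dstar by apply/andP; split; lra.
move=> /(_ isT) bb.
have {bb} : wminus f U c sstar (d * E + 4 * d) (b + k) x t <= u x (t + 1).
  have -> : u x (t + 1) = translate u 0 1 x t by rewrite /translate addr0.
  by apply: bb => y; rewrite /translate addr0 add0r (addrA y).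
apply: le_trans; rewrite /wminus -/F; apply: lerB.
  apply: wave_le; rewrite /b /k.
  have : 0 <= sstar * d * E * F := mulr_ge0 sdE (ltW F0).
  have : 0 <= sstar * d * F := mulr_ge0 (ltW sd) (ltW F0).
  lra.
have : d * E * F <= d * F := ler_wpM2r (ltW F0) dE1.
lra.
Qed.

(** The mirror image of [raise_below] for the upper barrier, which is displaced
    by [h]; the window has to be enlarged accordingly. *)
Lemma lower_above u d h r m M g t : trajectory u -> 0 <= h ->
  0 < d -> 5 * d <= dstar -> 0 <= t ->
  (forall z, derive1 U z <= M) -> M * (8 * sstar * d) <= g ->
  (forall z, r <= `|z| -> derive1 U z <= (2 * sstar)^-1) ->
  `|c| + h + 9 * sstar * d + r <= m ->
  (forall x, - m <= x <= m -> u x 1 <= wplus f U c sstar d h x 1 - g) ->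
  (forall x, u x 0 <= U (x + h) + d) ->
  forall x, u x (t + 1) <=
    U (x - c * (t + 1) + h - 3 * sstar * d) + 5 * d * expR (- beta * t).
Proof.
move=> tu h_ge0 d0 d5 t0 hM Mg hr hm hg h0 x.
have [dp sp] := (dstar_gt0, sstar_gt0).
have d1 : 0 < d <= dstar by rewrite d0; lra.
have /andP[E0 E1] := expR_beta_bounds (ler01 : 0 <= 1 :> R).
have /andP[F0 F1] := expR_beta_bounds t0.
set E := expR (- beta * 1) in E0 E1; set F := expR (- beta * t) in F0 F1 *.
have sd : 0 < sstar * d by exact: mulr_gt0.
have sdE : 0 <= sstar * d * E by rewrite mulr_ge0 ?ltW.
have sdE1 : sstar * d * E <= sstar * d by rewrite ler_piMr// ltW.
have dE : 0 <= d * E by rewrite mulr_ge0 ?ltW.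
have dE1 : d * E <= d by rewrite ler_piMr// ltW.
pose b := - c + (h + sstar * d * (1 - E)).
have wb y : wplus f U c sstar d h y 1 = U (y + b) + d * E.
  by rewrite /wplus -/E /b; congr (U _ + _); ring.
pose k := 8 * sstar * d.
have above1 y : u y 1 <= U (y + b - k) + (d * E + 4 * d).
  have -> : 4 * d = (2 * sstar)^-1 * k by rewrite /k; field; exact: lt0r_neq0.
  apply: (@shift_down (u^~ 1) b k (d * E) g (2 * sstar)^-1 r m M) => //.
  - by rewrite /k; lra.
  - by rewrite invr_ge0; lra.
  - have : `|b| <= `|c| + (h + sstar * d); last by rewrite /k; lra.
    rewrite /b (le_trans (ler_normD _ _))// normrN lerD2l ger0_norm; lra.
  - by move=> z; rewrite -wb; exact: barrier_above.
  - by move=> z /hg; rewrite wb.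
(* The barrier restarts at time 1 from the shifted wave. *)
have := @barrier_above (translate u 0 1) (b - k) (d * E + 4 * d) t.
move=> /(_ (trajectory_translate _ ler01 tu)) /(_ _ t0).
have -> : 0 < d * E + 4 * d <= dstar by apply/andP; split; lra.
move=> /(_ isT) bb.
have {bb} : u x (t + 1) <= wplus f U c sstar (d * E + 4 * d) (b - k) x t.
  have -> : u x (t + 1) = translate u 0 1 x t by rewrite /translate addr0.
  by apply: bb => y; rewrite /translate addr0 add0r (addrA y).
move/le_trans; apply; rewrite /wplus -/F; apply: lerD.
  apply: wave_le; rewrite /b /k.
  have : 0 <= sstar * d * E * F := mulr_ge0 sdE (ltW F0).
  have : 0 <= sstar * d * F := mulr_ge0 (ltW sd) (ltW F0).
  lra.
have : d * E * F <= d * F := ler_wpM2r (ltW F0) dE1.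
lra.
Qed.

Definition trapped (v : R -> R) (a h d : R) :=
  forall x, U (x + a) - d <= v x <= U (x + a + h) + d.

Lemma trappedW v a h d a' h' d' : a' <= a -> a + h <= a' + h' -> d <= d' ->
  trapped v a h d -> trapped v a' h' d'.
Proof.
move=> aa hh dd tv x; have /andP[v1 v2] := tv x.
have : U (x + a') <= U (x + a) by apply: wave_le; lra.
have : U (x + a + h) <= U (x + a' + h') by apply: wave_le; lra.
by move=> *; apply/andP; split; lra.
Qed.

(** A vertical error small compared with the gap lets one of the two bounds move
    inwards.  The ratio [A] depends on [H] through the window, which has to
    contain the steep parts of both translates, and through the minimal slope on
    [0, H + 1]. *)
Lemma squeeze_gain H : 0 < H -> exists2 A, 0 < A &
  forall h d u, 0 < h <= H -> 0 < d <= A * h -> trajectory u ->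
    trapped (u^~ 0) 0 h d ->
    forall t, 0 <= t ->
      (forall x, U (x - c * (t + 1) + 3 * sstar * d)
         - 5 * d * expR (- beta * t) <= u x (t + 1)) \/
      (forall x, u x (t + 1) <= U (x - c * (t + 1) + h - 3 * sstar * d)
         + 5 * d * expR (- beta * t)).
Proof.
move=> H0; have [dp sp] := (dstar_gt0, sstar_gt0).
have [M M0 hM] := wave_slope_bounded.
have q0 : 0 < (2 * sstar)^-1 by rewrite invr_gt0 mulr_gt0.
have [r r0 hr] := wave_flat q0.
have [e0 e00 he0] : exists2 e, 0 < e &
    forall x, 0 <= x <= H + 1 -> e <= derive1 U x.
  by apply: wave_slope_min; lra.
have [eta [eta_gt0 _ heta]] := low.
pose m := `|c| + H + 1 + r.
have m1 : 1 <= m by rewrite /m; have := normr_ge0 c; lra.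
have em := eta_gt0 m m1.
(* The four terms give 5 * d <= dstar, d <= 1 (so that the barriers stay in
   [-1, 2]), 9 * sstar * d <= 1 (so that the window is wide enough) and
   M * (8 * sstar * d) <= eta m * I below. *)
pose A := Num.min (dstar / (5 * H)) (Num.min H^-1 (Num.min (9 * sstar * H)^-1
  (eta m * e0 / (16 * M * sstar)))).
have A0 : 0 < A.
  have [? ? ?] : [/\ 0 < 5 * H, 0 < 9 * sstar * H & 0 < 16 * M * sstar].
    by split; rewrite !mulr_gt0.
  rewrite /A !lt_min; apply/and4P.
  by split; rewrite ?invr_gt0 ?divr_gt0 ?(mulr_gt0 em).
exists A => // h d u /andP[h0 hH] /andP[d0 dA] tu tr.
have : A <= A by [].
rewrite {2}/A !le_min -[H^-1]mul1r -[(9 * _ * _)^-1]mul1r.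
rewrite !ler_pdivlMr ?mulr_gt0// => /and4P[A1 A2 A3 A4].
have AhH : A * h <= A * H by rewrite ler_wpM2l// ltW.
have d5 : 5 * d <= dstar by lra.
have d1 : 0 < d <= 1 by rewrite d0; lra.
have sd9 : 9 * sstar * d <= 1.
  by have : sstar * d <= sstar * (A * H); [rewrite ler_pM2l//; lra|lra].
(* [2 * I] is a lower bound for the mass between the translates on [0, 1]. *)
pose I := e0 * h / 2.
have MI : M * (8 * sstar * d) <= eta m * I.
  have : A * (16 * M * sstar) * h <= eta m * e0 * h by rewrite ler_wpM2r// ltW.
  have : M * sstar * d <= M * sstar * (A * h).
    by rewrite ler_wpM2l// mulr_ge0 ?ltW.
  by rewrite /I; lra.
have mh : `|c| + h + 9 * sstar * d + r <= m by rewrite /m; lra.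
have m0 : `|c| + 9 * sstar * d + r <= m by rewrite /m; lra.
clear A1 A2 A3 A4 AhH dA sd9 A0.
move=> t t0.
have lower0 x : U x - d <= u x 0.
  by have /andP[+ _] := tr x; rewrite addr0.
have upper0 x : u x 0 <= U (x + h) + d.
  by have /andP[_ +] := tr x; rewrite addr0.
have dd : 0 < d <= dstar by rewrite d0; lra.
have [su bu _] := tu.
have [_ _ /(_ _ _ dd) hbar] := bar.
have u12 := trajectory_bounds tu.
have lower x : wminus f U c sstar d 0 x 0 <= u x 0 by rewrite wminus0 addr0.
have upper x : u x 0 <= wplus f U c sstar d h x 0 by rewrite wplus0.
have cU a : continuous (fun y => U (y + a)).
  move=> y; apply: (@continuous_comp _ _ _ (fun y => y + a) U).
    by apply: (@cvgD _ R); [exact: cvg_id|exact: cvg_cst].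
  exact: wave_continuous.
have := @mass_dichotomy R (u^~ 0) (fun y => wminus f U c sstar d 0 y 0)
  (fun y => wplus f U c sstar d h y 0) I.
case.
- by apply: continuous_slice; [case: su|exact: lexx].
- under eq_fun do rewrite wminus0.
  by move=> y; apply: (@cvgB _ R); [exact: cU|exact: cvg_cst].
- under eq_fun do rewrite wplus0.
  by move=> y; apply: (@cvgD _ R); [exact: cU|exact: cvg_cst].
- move=> y /andP[y0 y1]; rewrite wplus0 wminus0 addr0.
  have yh : y <= y + h by rewrite lerDl ltW.
  have [z /andP[z1 z2] ez] := wave_MVT yh.
  have : e0 * h <= derive1 U z * h.
    apply: (ler_wpM2r (ltW h0)); apply: he0; rewrite (le_trans y0 z1)/= (le_trans z2)//.
    by rewrite addrC lerD.
  by rewrite (addrC y h) addrK (addrC h y) in ez; rewrite /I; lra.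
- move=> hI; left; apply: (raise_below tu d0 d5 t0 hM MI hr m0 _ lower0).
  move=> x xm; have [_ sw] := hbar 0.
  rewrite addrC -lerBrDr.
  apply: le_trans (heta _ _ u12 (fun x s => wminus_bounds 0 x d1) su sw
    lower m m1 x xm).
  exact: (ler_wpM2l (ltW em)).
- move=> hI; right; apply: (lower_above tu (ltW h0) d0 d5 t0 hM MI hr mh _ upper0).
  move=> x xm; have [sw _] := hbar h; rewrite lerBrDr addrC -lerBrDr.
  apply: le_trans (heta _ _ (fun x s => wplus_bounds h x d1) u12 sw bu
    upper m m1 x xm).
  exact: (ler_wpM2l (ltW em)).
Qed.

(** Gap and vertical error are scaled by the same [s], so that the step can be iterated with
    the same constants.  With [H * (1 - rho) = 2 * (sstar * D)], a gain of
    [3 * sstar * d] on one side and a loss of [sstar * d] on the other shrink the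
    gap exactly by the factor [rho]. *)
Lemma squeeze_step H : 0 < H -> exists D N rho,
  [/\ 0 < D <= dstar, 0 < rho < 1, 2 * (sstar * D) = H * (1 - rho), (0 < N)%N &
  forall s u, 0 < s <= 1 -> trajectory u ->
    trapped (u^~ 0) 0 (H * s) (D * s) ->
    exists2 e, - (sstar * (D * s)) <= e <= 3 * (sstar * (D * s)) &
    trapped (u^~ N%:R) (e - c * N%:R) (H * (rho * s)) (D * (rho * s))].
Proof.
move=> H0; have [dp sp] := (dstar_gt0, sstar_gt0).
have [A A0 gain] := squeeze_gain H0.
have [n hn] : exists n : nat, expR (- beta * n%:R) <= 10^-1.
  by apply: expR_decay => //; rewrite invr_gt0.
(* The last term makes [rho >= 1 / 2]; the vertical error, at most
   5 * d / 10 after the time [n + 1], is then below [d * rho]. *)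
pose D := Num.min (A * H) (Num.min dstar (H / (4 * sstar))).
have D0 : 0 < D by rewrite /D !lt_min dp divr_gt0 ?mulr_gt0.
have : D <= D by [].
rewrite {2}/D !le_min => /and3P[D1 D2 D3].
have D4 : 4 * (sstar * D) <= H by rewrite ler_pdivlMr ?mulr_gt0// in D3; lra.
pose rho := 1 - 2 * (sstar * D) / H.
have Hrho : H * rho = H - 2 * (sstar * D) by rewrite /rho; field; exact: lt0r_neq0.
have sD0 : 0 < sstar * D by exact: mulr_gt0.
have rho_ge : 2^-1 <= rho by rewrite -(ler_pM2l H0) Hrho; lra.
have rho_lt1 : rho < 1 by rewrite -(ltr_pM2l H0) Hrho; lra.
exists D, n.+1, rho; split => //.
- by rewrite D0.
- by rewrite rho_lt1 andbT (lt_le_trans _ rho_ge)// invr_gt0.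
- by rewrite (mulrBr H 1 rho) mulr1 Hrho opprB addrC subrK.
move=> s u /andP[s0 s1] tu tr.
pose d := D * s; rewrite -/d in tr *.
have d0 : 0 < d by exact: mulr_gt0.
have dD : d <= D by rewrite ler_piMr// ltW.
have h0 : 0 < H * s <= H by rewrite mulr_gt0//= ler_piMr// ltW.
have dA : 0 < d <= A * (H * s) by rewrite d0 mulrA ler_wpM2r// ltW.
have drho : d * 2^-1 <= D * (rho * s).
  by rewrite (mulrC rho) (mulrA D) ler_wpM2l// ltW.
have hrho : H * (rho * s) = H * s - 2 * (sstar * d).
  by rewrite (mulrA H) Hrho /d; ring.
have n1 : n.+1%:R = n%:R + 1 :> R by rewrite -natr1.
have FG : expR (- beta * n.+1%:R) <= expR (- beta * n%:R).
  by rewrite ler_expR n1 !mulNr lerN2 mulrDr mulr1 lerDl ltW.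
have dF : d * expR (- beta * n%:R) <= d * 10^-1 by rewrite ler_wpM2l// ltW.
have dG : d * expR (- beta * n.+1%:R) <= d * expR (- beta * n%:R).
  by rewrite ler_wpM2l// ltW.
have sd0 : 0 < sstar * d by exact: mulr_gt0.
have sdG : 0 <= sstar * d * expR (- beta * n.+1%:R).
  by rewrite mulr_ge0 ?expR_ge0// ltW.
have dd : 0 < d <= dstar by rewrite d0 (le_trans dD).
have lower0 x : U (x + 0) - d <= u x 0 by have /andP[+ _] := tr x.
have upper0 x : u x 0 <= U (x + H * s) + d.
  by have /andP[_ +] := tr x; rewrite addr0.
have lower := barrier_below tu dd (ler0n R n.+1) lower0.
have upper := barrier_above tu dd (ler0n R n.+1) upper0.
have := gain _ _ _ h0 dA tu tr _ (ler0n R n).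
clear gain tr lower0 upper0 D1 D2 D3 dD dA h0 rho_ge rho_lt1 Hrho FG hn A0 D4 dd.
case=> hg.
- exists (3 * (sstar * d)); first by rewrite lexx andbT; lra.
  move=> x; rewrite n1; apply/andP; split.
    apply: le_trans (hg x); apply: lerB; last lra.
    by apply: wave_le; lra.
  rewrite -n1; apply: (le_trans (upper x)); rewrite /wplus; apply: lerD; last lra.
  by apply: wave_le; lra.
- exists (- (sstar * d)); first by rewrite lexx; lra.
  move=> x; apply/andP; split.
    apply: le_trans (lower x); rewrite /wminus; apply: lerB; last lra.
    by apply: wave_le; lra.
  rewrite n1; apply: (le_trans (hg x)); apply: lerD; last lra.
  by apply: wave_le; lra.
Qed.

Lemma trapped_translate u x0 tau t a h d :
  trapped ((translate u x0 tau)^~ t) a h d <->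
  trapped (u^~ (t + tau)) (a - x0) h d.
Proof.
split=> tr x.
  have := tr (x - x0); rewrite /translate subrK.
  by have -> : x - x0 + a = x + (a - x0) by ring.
rewrite /translate; have := tr (x + x0).
by have -> : x + x0 + (a - x0) = x + a by ring.
Qed.

(** The two barriers drift apart by at most [sstar * d] on each side, while the
    vertical error decays exponentially. *)
Lemma trapped_later u tau t a h d : trajectory u -> 0 <= tau <= t ->
  0 < d <= dstar -> trapped (u^~ tau) (a - c * tau) h d ->
  trapped (u^~ t) (a - c * t - sstar * d) (h + 2 * (sstar * d))
    (d * expR (- beta * (t - tau))).
Proof.
move=> tu /andP[tau0 tt] dd tr.
have s0 : 0 <= t - tau by rewrite subr_ge0.
have tu' := trajectory_translate 0 tau0 tu.
have /andP[E0 E1] := expR_beta_bounds s0.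
have tr' x : U (x + (a - c * tau)) - d <= translate u 0 tau x 0 <=
    U (x + (a - c * tau + h)) + d.
  by rewrite /translate addr0 add0r (addrA x _ h); exact: tr.
have sd0 : 0 < sstar * d by rewrite mulr_gt0//; case/andP: dd.
have sdE : 0 <= sstar * d * expR (- beta * (t - tau)) by rewrite mulr_ge0 ?ltW.
move=> x.
have -> : u x t = translate u 0 tau x (t - tau) by rewrite /translate addr0 subrK.
apply/andP; split.
  have lo y : U (y + (a - c * tau)) - d <= translate u 0 tau y 0.
    by case/andP: (tr' y).
  apply: le_trans (barrier_below tu' dd s0 lo x).
  by rewrite /wminus lerB//; apply: wave_le; lra.
have hi y : translate u 0 tau y 0 <= U (y + (a - c * tau + h)) + d.
  by case/andP: (tr' y).
apply: le_trans (barrier_above tu' dd s0 hi x) _.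
by rewrite /wplus lerD//; apply: wave_le; lra.
Qed.

(** The phase [b n] drifts between [- sstar * d] and [3 * sstar * d] in a step.
    As [sstar * D] is [H / 2 * (1 - rho)], the drifts telescope, and the
    intervals from [b n - H / 2 * rho ^+ n] to [b n + 3 * (H / 2 * rho ^+ n)]
    are nested. *)
Lemma squeeze_converges H : 0 < H -> exists D N rho,
  [/\ 0 < D <= dstar, 0 < rho < 1, (0 < N)%N &
  forall u (tau : nat) a, trajectory u ->
    trapped (u^~ tau%:R) (a - c * tau%:R) H D ->
    exists xi, forall n,
      trapped (u^~ (tau + n * N)%:R)
        (xi - 3 / 2 * (H * rho ^+ n) - c * (tau + n * N)%:R)
        (3 * (H * rho ^+ n)) (D * rho ^+ n)].
Proof.
move=> H0; have [D [N [rho [D0 rho01 Drho N0 step]]]] := squeeze_step H0.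
exists D, N, rho; split=> // u tau a tu tr0.
have /andP[r0 r1] := rho01.
pose t n : R := (tau + n * N)%:R.
pose P n b := trapped (u^~ (t n)) (b - c * t n) (H * rho ^+ n) (D * rho ^+ n).
have next n b : exists b', P n b -> P n.+1 b' /\
    - (sstar * (D * rho ^+ n)) <= b' - b <= 3 * (sstar * (D * rho ^+ n)).
  have [Pnb|] := pselect (P n b); last by exists 0.
  have rn : 0 < rho ^+ n <= 1 by rewrite exprn_gt0//= exprn_ile1// ltW.
  have tn0 : 0 <= t n by exact: ler0n.
  have := step _ _ rn (trajectory_translate (c * t n - b) tn0 tu).
  case; first by apply/trapped_translate; rewrite add0r sub0r opprB.
  move=> e he /trapped_translate tr; exists (b + e) => _.
  split; last by rewrite addrAC subrr add0r.
  move: tr; rewrite /P exprS.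
  have -> : t n.+1 = N%:R + t n by rewrite /t mulSn -natrD addnCA.
  by have -> : e - c * N%:R - (c * t n - b) = b + e - c * (N%:R + t n) by ring.
(* Dependent choice of the phases. *)
have [F hF] := choice (fun p : nat * R => next p.1 p.2).
pose fix b n := if n is k.+1 then F (k, b k) else a.
have Pb n : P n (b n).
  elim: n => [|n IH]; first by rewrite /P /t mul0n addn0 !expr0 !mulr1.
  by have [] := hF (n, b n) IH.
have drift n := (hF (n, b n) (Pb n)).2; rewrite /= in drift.
pose h n := H / 2 * rho ^+ n.
have hS n : h n.+1 = h n - sstar * (D * rho ^+ n).
  have e : H * (1 - rho) / 2 = sstar * D by rewrite -Drho mulrC mulKf.
  by rewrite /h exprS mulrA (mulrA sstar) -e; field.
have [xi hxi] : exists xi, forall n, b n - h n <= xi <= b n + 3 * h n.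
  apply: nested_intervals => n.
  - by have /andP[+ _] := drift n; rewrite hS /=; lra.
  - by have /andP[_ +] := drift n; rewrite hS /=; lra.
  - have : 0 < h n by rewrite /h mulr_gt0 ?divr_gt0 ?exprn_gt0.
    by lra.
exists xi => n; have /andP[x1 x2] := hxi n; rewrite /h in x1 x2.
by apply: trappedW (Pb n); rewrite // -/(t n); lra.
Qed.

(** * Common phase of all solutions with the same datum *)

(** The lower-bound property compares ordered data even when they coincide; the
    integral is then 0. *)
Lemma trajectories_ordered u v : trajectory u -> trajectory v ->
  (forall x, u x 0 = v x 0) -> forall x, v x 1 <= u x 1.
Proof.
move=> tu tv uv x; have [eta [_ _ heta]] := low.
have [[su _ _] [_ bv _]] := (tu, tv).
have xm : - (`|x| + 1) <= x <= `|x| + 1 by rewrite -ler_norml lerDl.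
have vu y : v y 0 <= u y 0 by rewrite uv.
have m1 : 1 <= `|x| + 1 by rewrite lerDr.
have := heta u v (trajectory_bounds tu) (trajectory_bounds tv) su bv vu _ m1 x xm.
rewrite (_ : \int[lebesgue_measure]_(y in `[0, 1]) (u y 0 - v y 0) = 0).
  by rewrite mulr0 subr_ge0.
by rewrite /Rintegral integral0_eq// => y _; rewrite uv subrr.
Qed.

Lemma trajectories_agree u v : trajectory u -> trajectory v ->
  (forall x, u x 0 = v x 0) -> forall (n : nat) x, u x n%:R = v x n%:R.
Proof.
move=> tu tv uv; elim=> [//|n IH] x.
have tu' := trajectory_translate 0 (ler0n R n) tu.
have tv' := trajectory_translate 0 (ler0n R n) tv.
have e w : w x n.+1%:R = translate w 0 n%:R x 1 :> R.
  by rewrite /translate addr0 -natr1 addrC.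
have uv' y : translate u 0 n%:R y 0 = translate v 0 n%:R y 0.
  by rewrite /translate addr0 add0r.
rewrite !e; apply: le_anti; apply/andP; split.
  exact: trajectories_ordered.
exact: trajectories_ordered.
Qed.

(** * Exponential convergence *)

(** For [X1 < x] the lower bound follows from [U < 1], and elsewhere from
    [0 <= u0] if [a] is so small that [U (x + a) <= d]; the upper bound is
    symmetric. *)
Lemma trapped_initially (u0 : R -> R) d X1 X2 : 0 < d ->
  (forall x, 0 <= u0 x <= 1) -> (forall x, X1 < x -> 1 - d <= u0 x) ->
  (forall x, x < X2 -> u0 x <= d) -> exists a h, 0 < h /\ trapped u0 a h d.
Proof.
move=> d0 u01 h1 h2; have [r Ur] := wave_small d0.
have [r' Ur'] : exists r, 1 - d < U r by apply: wave_large; lra.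
pose a := r - X1; pose b := Num.max (r' - X2) (a + 1).
have b1 : r' - X2 <= b by rewrite /b le_max lexx.
have b2 : a + 1 <= b by rewrite /b le_max lexx orbT.
exists a, (b - a); split; first lra.
move=> x; have /andP[ux0 ux1] := u01 x.
have := wave_lt1 (x + a); have := wave_gt0 (x + a + (b - a)) => Ug Ul.
apply/andP; split.
  have [/h1|xX] := ltP X1 x; first lra.
  have : U (x + a) <= U r by apply: wave_le; rewrite /a; lra.
  lra.
have [/h2|xX] := ltP x X2; first lra.
have : U r' <= U (x + a + (b - a)) by apply: wave_le; lra.
lra.
Qed.

Lemma trapped_dist (v : R -> R) a w d M : (forall z, derive1 U z <= M) ->
  0 <= w -> trapped v (a - w) (2 * w) d ->
  forall x, `|v x - U (x + a)| <= d + M * w.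
Proof.
move=> hM w0 tr x; have /andP[v1 v2] := tr x.
have : U (x + a) <= U (x + (a - w)) + M * (x + a - (x + (a - w))).
  by apply: wave_increment => [|z _]; [lra|exact: hM].
have : U (x + (a - w) + 2 * w) <= U (x + a) + M * (x + (a - w) + 2 * w - (x + a)).
  by apply: wave_increment => [|z _]; [lra|exact: hM].
by move=> *; rewrite ler_norml; apply/andP; split; lra.
Qed.

(** This is the transient phase: its duration depends on the initial gap, hence on
    the datum. *)
Lemma trapped_eventually u a h d : trajectory u -> 0 < h -> 0 < d <= dstar ->
  trapped (u^~ 0) a h d -> forall D, 0 < D -> exists (tau : nat) a',
  trapped (u^~ tau%:R) (a' - c * tau%:R) 1 D.
Proof.
move=> tu h0 /[dup] dd /andP[d0 _] tr D D0.
have sp := sstar_gt0.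
pose H := h + 2 * (sstar * d).
have H0 : 0 < H by rewrite /H; have := mulr_gt0 sp d0; lra.
have [DH [N [rho [/andP[DH0 DHd] rho01 _ conv]]]] := squeeze_converges H0.
have [k hk] := expR_decay beta_gt0 (divr_gt0 DH0 d0).
have k0 : 0 <= (0 : R) <= k%:R by rewrite lexx ler0n.
have tr0 : trapped (u^~ 0) (a - c * 0) h d by rewrite mulr0 subr0.
have trk : trapped (u^~ k%:R) (a - sstar * d - c * k%:R) H DH.
  apply: trappedW (trapped_later tu k0 dd tr0); [lra|rewrite /H; lra|].
  by rewrite subr0 mulrC -ler_pdivlMr.
have [xi hxi] := conv u k _ tu trk.
pose e := Num.min (3 * H)^-1 (D / DH).
have e0 : 0 < e by rewrite /e lt_min invr_gt0 mulr_gt0//= divr_gt0.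
have [n hn] := geometric_decay rho01 e0.
have {hn} /andP[n1 n2] : (rho ^+ n <= (3 * H)^-1) && (rho ^+ n <= D / DH).
  by rewrite -le_min.
exists (k + n * N)%N, (xi - 3 / 2 * (H * rho ^+ n)).
apply: trappedW (hxi n) => //.
  have : rho ^+ n * (3 * H) <= 1 by rewrite -ler_pdivlMr ?mulr_gt0// mul1r.
  lra.
by rewrite mulrC -ler_pdivlMr.
Qed.

(** [kappa] comes from the iteration with unit gap.  The phase [xi] is constructed
    from one solution [us], and another solution [u] inherits the bounds of [us]
    at the integer times of the iteration, between which the barriers control
    it. *)
Lemma wave_stability : exists2 kappa, 0 < kappa & forall (u0 : R -> R) a h d,
  0 < h -> 0 < d <= dstar -> trapped u0 a h d ->
  exists xi K, forall u, trajectory u -> (forall x, u x 0 = u0 x) ->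
  forall x t, 0 <= t ->
    `|u x t - U (x - c * t + xi)| <= K * expR (- kappa * t).
Proof.
have [D [N [rho [D0 /[dup] rho01 /andP[r0 r1] N0 conv]]]] :=
  squeeze_converges ltr01.
have [M M0 hM] := wave_slope_bounded; have sp := sstar_gt0.
have NR : 0 < N%:R :> R by rewrite ltr0n.
pose kappa := - ln rho / N%:R.
have kappa0 : 0 < kappa by rewrite divr_gt0// oppr_gt0 ln_lt0.
have kN n : expR (- kappa * (n%:R * N%:R)) = rho ^+ n.
  rewrite (_ : - kappa * _ = n%:R * ln rho) ?expRM_natl ?lnK ?posrE//.
  by rewrite /kappa; field; exact: lt0r_neq0.
exists kappa => // u0 a h d h0 dd tr.
have [[us [tus us0]]|nou] := pselect (exists u, trajectory u /\
    forall x, u x 0 = u0 x); last first.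
  by exists 0, 0 => u tu hu; exfalso; apply: nou; exists u.
have {}tr : trapped (us^~ 0) a h d by move=> x; rewrite us0; exact: tr.
have /andP[Dp _] := D0.
have [tau [a' tr']] := trapped_eventually tus h0 dd tr Dp.
have [xi hxi] := conv us tau a' tus tr'.
pose w := 3 / 2 + sstar * D.
have w0 : 0 <= w by rewrite /w addr_ge0// mulr_ge0 ?ltW.
pose G := D + M * w.
have G0 : 0 <= G by rewrite /G addr_ge0 ?mulr_ge0// ltW.
(* Before the time [tau] the bound 1 suffices; after it, the iteration controls
   [t] from the last step [n] before it, which costs the factor [rho^-1]. *)
exists xi, (expR (kappa * tau%:R) * (1 + G / rho)).
move=> u tu u_u0 x t t0.
have e0 : 0 < expR (kappa * tau%:R) * expR (- kappa * t).
  by rewrite mulr_gt0 ?expR_gt0.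
have eE : expR (kappa * tau%:R) * expR (- kappa * t) =
    expR (- kappa * (t - tau%:R)).
  by rewrite -expRD; congr expR; ring.
rewrite mulrAC mulrDr mulr1; have [tt|tt] := ltP t tau%:R.
  apply: (@le_trans _ _ 1).
    have [_ _ /(_ x t t0)/andP[u1 u2]] := tu.
    have := wave_gt0 (x - c * t + xi); have := wave_lt1 (x - c * t + xi).
    by move=> *; rewrite ler_norml; apply/andP; split; lra.
  apply: (@le_trans _ _ (expR (kappa * tau%:R) * expR (- kappa * t))).
    rewrite eE -[leLHS]expR0 ler_expR mulNr oppr_ge0 mulr_ge0_le0// ?ltW//.
    by rewrite subr_lt0.
  by rewrite lerDl (mulr_ge0 (ltW e0))// divr_ge0// ltW.
have s0 : 0 <= (t - tau%:R) / N%:R by rewrite divr_ge0 ?subr_ge0 ?ler0n.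
have /andP[n1 n2] := truncn_itv s0.
set n := Num.truncn _ in n1 n2.
rewrite ler_pdivlMr// in n1; rewrite ltr_pdivrMr// in n2.
have tn : (tau + n * N)%:R = tau%:R + n%:R * N%:R :> R by rewrite natrD natrM.
have tnt : 0 <= ((tau + n * N)%:R : R) <= t by rewrite ler0n tn; lra.
have rn0 : 0 < rho ^+ n by rewrite exprn_gt0.
have Drn : 0 < D * rho ^+ n <= dstar.
  rewrite mulr_gt0//=; case/andP: D0 => _; apply: le_trans.
  by rewrite ler_piMr// ?exprn_ile1 ?ltW.
have tru : trapped (u^~ (tau + n * N)%:R)
    (xi - 3 / 2 * rho ^+ n - c * (tau + n * N)%:R) (3 * rho ^+ n) (D * rho ^+ n).
  move=> y; rewrite (trajectories_agree tu tus) => [|z]; last by rewrite u_u0 us0.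
  by have := hxi n y; rewrite mul1r.
have /andP[_ E1] : 0 < expR (- beta * (t - (tau + n * N)%:R)) <= 1.
  by apply: expR_beta_bounds; rewrite subr_ge0; case/andP: tnt.
have trt : trapped (u^~ t) (- (c * t) + xi - w * rho ^+ n)
    (2 * (w * rho ^+ n)) (D * rho ^+ n).
  apply: trappedW (trapped_later tu tnt Drn tru); [rewrite /w; lra|rewrite /w; lra|].
  by rewrite ler_piMr// ltW//; case/andP: Drn.
have := trapped_dist hM (mulr_ge0 w0 (ltW rn0)) trt x.
rewrite addrA => /le_trans; apply.
apply: (@le_trans _ _ (G * rho ^+ n)); first by rewrite /G; lra.
apply: (@le_trans _ _
  (expR (kappa * tau%:R) * expR (- kappa * t) * (G / rho))); last first.
  by rewrite lerDr ltW.
have : rho ^+ n.+1 <= expR (kappa * tau%:R) * expR (- kappa * t).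
  by rewrite eE -kN ler_expR !mulNr lerN2 ler_wpM2l// ltW.
rewrite exprS => h1; rewrite mulrC mulrA ler_pdivlMr//.
by rewrite mulrAC (mulrC _ rho) ler_wpM2r.
Qed.

End Wave.

Unset Implicit Arguments.

Theorem theoremB1 (R : realType) (alpha theta : R) (f : R -> R) (am ap : R)
    (U : R -> R) (c dstar sstar delta : R) :
  1 < alpha <= 2 ->
  `|theta| <= Num.min alpha (2 - alpha) ->
  smooth f ->
  f 0 = 0 -> f 1 = 0 -> derive1 f 0 < 0 -> derive1 f 1 < 0 ->
  0 < am -> am <= ap -> ap < 1 ->
  (forall s, -1 < s < 0 \/ ap < s < 1 -> 0 < f s) ->
  (forall s, 0 < s < am \/ 1 < s < 2 -> f s < 0) ->
  comparison_property alpha theta f ->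
  linearization_property alpha theta f ->
  lower_bound_property alpha theta f ->
  estimate_property alpha theta f ->
  traveling_wave alpha theta f U c ->
  U @ -oo --> (0 : R) ->
  U @ +oo --> (1 : R) ->
  (forall x, 0 < derive1 U x) ->
  derive1 U @ -oo --> (0 : R) ->
  derive1 U @ +oo --> (0 : R) ->
  barrier_constants alpha theta f U c dstar sstar ->
  0 < delta ->
  delta <= Num.min (Num.min 1 (1 / sstar) * (dstar / 2))
             (Num.min (am / 2) ((1 - ap) / 2)) ->
  exists kappa : R, 0 < kappa /\
    forall u0 : R -> R,
      Cb u0 ->
      (forall x, 0 <= u0 x <= 1) ->
      ((1 - delta)%:E < limf_einf (EFin \o u0) (pinfty_nbhs R))%E ->
      ap < 1 - delta ->
      (limf_esup (EFin \o u0) (ninfty_nbhs R) < delta%:E)%E ->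
      delta < am ->
      exists xi K : R,
        forall u : R -> R -> R, solution alpha theta f u0 u ->
        forall t : R, 0 <= t ->
          ('N[(@lebesgue_measure R)]_+oo [(fun x : R => (u x t - U (x - c * t + xi))%:E)]
             <= (K * expR (- kappa * t))%:E)%E.
Proof.
move=> _ _ _ f0 f1 df0 df1 am0 amap ap1 _ _ cmp _ low _ [U2 _] U0 U1 dU dU0 dU1.
move=> bar d0; rewrite !le_min => /andP[dd _].
have [dp sp _] := bar.
have beta_gt0 : 0 < beta_rate f.
  by rewrite /beta_rate mulr_gt0 ?invr_gt0// lt_min !oppr_gt0 df0.
have d1 : 0 < delta <= dstar.
  rewrite d0 (le_trans dd)//; apply: (@le_trans _ _ (1 * (dstar / 2))); last lra.
  by rewrite ler_wpM2r ?ge_min ?lexx// divr_ge0// ltW.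
have [kappa k0 stab] :=
  wave_stability cmp low U2 U0 U1 dU dU0 dU1 bar beta_gt0.
exists kappa; split=> // u0 _ u01 hinf apd hsup dam.
have [X1 hX1] := liminf_pinfty_gt hinf.
have [X2 hX2] := limsup_ninfty_lt hsup.
have [a [h [h0 tr]]] := trapped_initially U2 U0 U1 dU d0 u01
  (fun x hx => ltW (hX1 x hx)) (fun x hx => ltW (hX2 x hx)).
have [xi [K hK]] := stab _ _ _ _ h0 d1 tr.
exists xi, K => u su t t0; apply: Lnormy_le => x; apply: hK => //; last first.
  by case: su.
apply: solution_trajectory su => //.
- exists (X1 + 1); rewrite gt_eqF//; have := hX1 (X1 + 1).
  by rewrite ltrDl ltr01 => /(_ isT); lra.
- exists (X2 - 1); rewrite lt_eqF//; have := hX2 (X2 - 1).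
  by rewrite ltrBlDr ltrDl ltr01 => /(_ isT); lra.
Qed.
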